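(* Let $D$, $H$ be Bott equivalent acyclic digraphs on $n$ vertices. Then: (i) $\rho_D\left(\bigcup_{i\in I}L_i(D)\right)=\rho_H\left(\bigcup_{i\in I}L_i(H)\right)$ for every subset $I$ of $\{0,1,2,\dots,n-1\}$; (ii) $\rho_D(L_i(D),L_{i+1}(D))=\rho_H(L_i(H),L_{i+1}(H))$ for all $i\in\{0,1,2,\dots,n-2\}$.
   Context: A digraph $D=(V,E)$ consists of a finite vertex set $V=V(D)$ and a set $E$ of ordered pairs $(u,v)$ of distinct vertices (arcs). $D$ is acyclic if its vertices can be ordered $v_1,\dots,v_n$ so that $i<j$ for each arc $(v_i,v_j)$. Let $N_D^+(v)=\{w:(v,w)\in E\}$ (out-neighbors) and $N_D^-(v)=\{u:(u,v)\in E\}$ (in-neighbors). Bott equivalence. Local complementation at a vertex $v$: $D*v$ is the digraph obtained from $D$ by toggling (adding if absent, removing if present) the arc $(u,w)$ for each pair $(u,w)\in N_D^-(v)\times N_D^+(v)$ with $u\ne w$. Slide: for two distinct vertices $v,w$ with $N_D^-(v)=N_D^-(w)$, $D\Delta vw$ is the digraph obtained from $D$ by replacing $N_D^+(w)$ by the symmetric difference $N_D^+(w)\Delta N_D^+(v)$. These operations preserve acyclicity. An acyclic digraph $H$ is Bott equivalent to an acyclic digraph $D$ if $H$ is isomorphic to a digraph obtained from $D$ by successively applying (finitely many) local complementations and slides. Levels. For an acyclic digraph $D$, $L_k(D)$ is the set of vertices $v$ such that a longest directed path of $D$ ending at $v$ has exactly $k$ edges. Cut-rank. The adjacency matrix $A_D$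 of $D$ has rows and columns indexed by $V(D)$, with $(u,v)$ entry $1$ if $(u,v)\in E$ and $0$ otherwise. For $X,Y\subseteq V(D)$, $A_D[X,Y]$ is the submatrix of $A_D$ with rows indexed by $X$ and columns indexed by $Y$; $\rho_D(X,Y)$ is the rank of $A_D[X,Y]$ over $\mathbb{Z}_2$ (zero if $X$ or $Y$ is empty), and $\rho_D(X)=\rho_D(X,V(D)\setminus X)$. *)

(* Defs.v *)
From mathcomp Require Import all_boot all_order all_algebra.

Set Implicit Arguments.
Unset Strict Implicit.
Unset Printing Implicit Defensive.

Record digraph (V : finType) := Digraph {
  arcs : {set V * V};
  arcs_loopless : [forall v, (v, v) \notin arcs]
}.

Section Digraph.
Variable V : finType.
Implicit Types (D : digraph V) (u v w x : V) (X Y : {set V}).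

Definition arc D : rel V := fun u v => (u, v) \in arcs D.

Definition out_nbrs D v : {set V} := [set w | arc D v w].
Definition in_nbrs D v : {set V} := [set u | arc D u v].

Lemma arc_irrefl D v : arc D v v = false.
Proof. exact/negbTE/(forallP (arcs_loopless D)). Qed.

(* A duplicate-free tuple of length #|V| lists every vertex exactly once. *)
Definition acyclic D : Prop :=
  exists s : #|V|.-tuple V,
    uniq s /\
    forall i j : 'I_#|V|, arc D (tnth s i) (tnth s j) -> i < j.

Definition local_compl_arcs D v : {set V * V} :=
  [set e | (e \in arcs D)
           (+) [&& e.1 \in in_nbrs D v, e.2 \in out_nbrs D v & e.1 != e.2]].

Lemma local_compl_loopless D v :
  [forall u, (u, u) \notin local_compl_arcs D v].
Proof.
apply/forallP => u; rewrite inE /= eqxx !andbF addbF.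
by rewrite -/(arc D u u) arc_irrefl.
Qed.

Definition local_compl D v : digraph V := Digraph (local_compl_loopless D v).

Definition symdiff X Y : {set V} := (X :\: Y) :|: (Y :\: X).

Definition slide_arcs D v w : {set V * V} :=
  [set e | if e.1 == w then e.2 \in symdiff (out_nbrs D w) (out_nbrs D v)
           else e \in arcs D].

Lemma slide_loopless D v w :
  in_nbrs D v = in_nbrs D w -> [forall u, (u, u) \notin slide_arcs D v w].
Proof.
move=> eqN; apply/forallP => u; rewrite inE /=.
case: eqP => [->|_]; last by rewrite -/(arc D u u) arc_irrefl.
have : (v \in in_nbrs D v) = (v \in in_nbrs D w) by rewrite eqN.
by rewrite !inE !arc_irrefl => <-.
Qed.

(* The equality of in-neighborhoods is an argument because the result may
   have a loop at w without it. *)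
Definition slide D v w (eqN : in_nbrs D v = in_nbrs D w) : digraph V :=
  Digraph (slide_loopless eqN).

Inductive bott_reachable D : digraph V -> Prop :=
| bott_refl : bott_reachable D D
| bott_local_compl D' v :
    bott_reachable D D' -> bott_reachable D (local_compl D' v)
| bott_slide D' v w (eqN : in_nbrs D' v = in_nbrs D' w) :
    v != w -> bott_reachable D D' -> bott_reachable D (slide eqN).

Definition has_path_to D v (k : nat) : bool :=
  [exists x, [exists p : k.-tuple V,
    [&& path (arc D) x p, uniq (x :: p) & last x p == v]]].

(* A path has distinct vertices, hence fewer than #|V| edges; the one-vertex
   path makes k = 0 always admissible, so the maximum is attained. *)
Definition longest_path_to D v : nat :=
  \max_(k < #|V| | has_path_to D v k) k.

Definition level D (k : nat) : {set V} := [set v | longest_path_to D v == k].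

Definition adj_mx D : 'M['F_2]_#|V| :=
  (\matrix_(i, j) (arc D (enum_val i) (enum_val j))%:R)%R.

Definition adj_submx D X Y : 'M['F_2]_(#|X|, #|Y|) :=
  mxsub (fun i : 'I_#|X| => enum_rank (enum_val i))
        (fun j : 'I_#|Y| => enum_rank (enum_val j)) (adj_mx D).

Definition cut_rank2 D X Y : nat := \rank (adj_submx D X Y).

Definition cut_rank D X : nat := cut_rank2 D X (~: X).

End Digraph.

Definition digraph_iso (V W : finType) (D : digraph V) (H : digraph W) : Prop :=
  exists2 f : V -> W, bijective f & forall u v, arc H (f u) (f v) = arc D u v.

Definition bott_equivalent (V W : finType) (H : digraph W) (D : digraph V) :
    Prop :=
  exists2 D' : digraph V, bott_reachable D D' & digraph_iso D' H.

(* Main.v *)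
(** Call [l : V -> nat] a grading if it increases strictly along arcs and every
    vertex of positive grade has an in-neighbor exactly one grade below. Such a
    function is necessarily the longest-path level. Local complementation only
    toggles arcs that jump at least two grades, and a slide at [v, w] involves
    two vertices of the same grade, so both moves keep the grading. On the
    adjacency matrix, local complementation at [v] adds row [v] to the rows in
    [N^-(v)] or, what is the same, column [v] to the columns in [N^+(v)], and a
    slide adds row [v] to row [w]. The pivot [v] always lies on one side of the
    cut, so the cut-rank of a union of levels does not change. *)
From mathcomp Require Import all_boot all_order all_algebra.
Require Import Defs.

Set Implicit Arguments.
Unset Strict Implicit.
Unset Printing Implicit Defensive.

Import GRing.Theory.

(** * Rank under elementary row and column operations *)

Section MatrixRank.
Variable F : fieldType.
Local Open Scope ring_scope.

(** Since [c k = 0], row [k] is the same in both matrices, so subtracting the same multiples of it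
    undoes the operation. Each row space therefore contains the other. *)
Lemma mxrank_add_row m n (A B : 'M[F]_(m, n)) (c : 'I_m -> F) (k : 'I_m) :
  c k = 0 -> (forall i j, B i j = A i j + c i * A k j) -> \rank B = \rank A.
Proof.
move=> ck0 defB.
have rowB i : row i B = row i A + c i *: row k A.
  by apply/rowP => j; rewrite !mxE defB.
have rowkB : row k B = row k A by rewrite rowB ck0 scale0r addr0.
suff /eqmxP -> : (B == A)%MS by [].
apply/andP; split; apply/row_subP => i.
  by rewrite rowB addmx_sub ?scalemx_sub ?row_sub.
have -> : row i A = row i B - c i *: row k B by rewrite rowkB rowB addrK.
by rewrite -scaleNr addmx_sub ?scalemx_sub ?row_sub.
Qed.

Lemma mxrank_add_col m n (A B : 'M[F]_(m, n)) (c : 'I_n -> F) (k : 'I_n) :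
  c k = 0 -> (forall i j, B i j = A i j + A i k * c j) -> \rank B = \rank A.
Proof.
move=> ck0 defB; rewrite -mxrank_tr -(mxrank_tr A).
by apply: (mxrank_add_row ck0) => i j; rewrite !mxE defB mulrC.
Qed.

(** Selected rows stay in the row space, and columns are handled by transposing. Neither [f] nor [g]
    has to be injective. *)
Lemma mxrank_mxsub m n p q (f : 'I_p -> 'I_m) (g : 'I_q -> 'I_n)
    (A : 'M[F]_(m, n)) :
  (\rank (mxsub f g A) <= \rank A)%N.
Proof.
have rank_rowsub r s t (h : 'I_r -> 'I_s) (B : 'M[F]_(s, t)) :
    (\rank (rowsub h B) <= \rank B)%N.
  by apply/mxrankS/row_subP => i; rewrite row_rowsub row_sub.
have -> : mxsub f g A = rowsub f (rowsub g A^T)^T.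
  by apply/matrixP => i j; rewrite !mxE.
by rewrite (leq_trans (rank_rowsub _ _ _ _ _)) // mxrank_tr -(mxrank_tr A).
Qed.

End MatrixRank.

(** * Cut-rank under row and column operations and isomorphism *)

Section CutRank.
Variable V : finType.
Implicit Types (D : digraph V) (u v w : V) (X Y : {set V}).

Lemma adj_submxE D X Y i j :
  adj_submx D X Y i j = ((arc D (enum_val i) (enum_val j))%:R)%R.
Proof. by rewrite !mxE !enum_rankK. Qed.

Lemma natr_addb (b c : bool) : ((b (+) c)%:R = b%:R + c%:R :> 'F_2)%R.
Proof. by apply/val_inj; case: b c => [] []. Qed.

Lemma natr_andb (b c : bool) : ((b && c)%:R = b%:R * c%:R :> 'F_2)%R.
Proof. by apply/val_inj; case: b c => [] []. Qed.

Lemma cut_rank2_add_row D D' X Y (c : pred V) v :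
    v \in X -> ~~ c v ->
    {in X & Y, forall u w, arc D' u w = arc D u w (+) (c u && arc D v w)} ->
  cut_rank2 D' X Y = cut_rank2 D X Y.
Proof.
move=> vX cv arcD'; have vE := enum_rankK_in vX vX.
apply: (@mxrank_add_row _ _ _ _ _ (fun i => (c (enum_val i))%:R)%R
  (enum_rank_in vX v)) => [|i j]; first by rewrite vE (negbTE cv).
by rewrite !adj_submxE vE arcD' ?enum_valP // natr_addb natr_andb.
Qed.

Lemma cut_rank2_add_col D D' X Y (c : pred V) v :
    v \in Y -> ~~ c v ->
    {in X & Y, forall u w, arc D' u w = arc D u w (+) (arc D u v && c w)} ->
  cut_rank2 D' X Y = cut_rank2 D X Y.
Proof.
move=> vY cv arcD'; have vE := enum_rankK_in vY vY.
apply: (@mxrank_add_col _ _ _ _ _ (fun i => (c (enum_val i))%:R)%R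
  (enum_rank_in vY v)) => [|i j]; first by rewrite vE (negbTE cv).
by rewrite !adj_submxE vE arcD' ?enum_valP // natr_addb natr_andb.
Qed.

Lemma eq_cut_rank2 D D' X Y :
  {in X & Y, arc D' =2 arc D} -> cut_rank2 D' X Y = cut_rank2 D X Y.
Proof.
move=> eqD; congr (\rank _); apply/matrixP => i j.
by rewrite !adj_submxE eqD ?enum_valP.
Qed.

End CutRank.

(** Through [f], the matrix of [D] is a selection of rows and columns of that of [H]. An isomorphism
    gives equality by using this for [f] and for its inverse. *)
Lemma cut_rank2_le (V W : finType) (D : digraph V) (H : digraph W) (f : V -> W)
    (X Y : {set V}) (X' Y' : {set W}) :
    {homo f : u / u \in X >-> u \in X'} -> {homo f : u / u \in Y >-> u \in Y'} ->
    (forall u v, arc H (f u) (f v) = arc D u v) ->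
  cut_rank2 D X Y <= cut_rank2 H X' Y'.
Proof.
move=> fX fY arcf; rewrite /cut_rank2.
pose r (i : 'I_#|X|) := enum_rank_in (fX _ (enum_valP i)) (f (enum_val i)).
pose s (j : 'I_#|Y|) := enum_rank_in (fY _ (enum_valP j)) (f (enum_val j)).
have -> : adj_submx D X Y = mxsub r s (adj_submx H X' Y').
  apply/matrixP => i j; rewrite [RHS]mxE !adj_submxE.
  by rewrite !enum_rankK_in ?fX ?fY ?enum_valP // arcf.
exact: mxrank_mxsub.
Qed.

Lemma cut_rank2_iso (V W : finType) (D : digraph V) (H : digraph W)
    (f : V -> W) (X Y : {set V}) (X' Y' : {set W}) :
    bijective f -> (forall u v, arc H (f u) (f v) = arc D u v) ->
    (forall u, (f u \in X') = (u \in X)) ->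
    (forall u, (f u \in Y') = (u \in Y)) ->
  cut_rank2 H X' Y' = cut_rank2 D X Y.
Proof.
move=> [g fK gK] arcf fX fY; apply/eqP; rewrite eqn_leq; apply/andP; split.
  by apply: (@cut_rank2_le _ _ _ _ g) => [u|u|u v];
    rewrite -?fX -?fY -?arcf ?gK.
by apply: (@cut_rank2_le _ _ _ _ f) => // u; rewrite ?fX ?fY.
Qed.

(** * Gradings and longest-path levels *)

Definition graded (V : finType) (D : digraph V) (l : V -> nat) : Prop :=
  {homo l : u w / arc D u w >-> u < w} /\
  (forall w, 0 < l w -> exists2 u, arc D u w & (l u).+1 = l w).

Section Levels.
Variable V : finType.
Implicit Types (D : digraph V) (u v w : V) (l : V -> nat).

Lemma has_path_toP D v k :
  reflect (exists x p, [/\ path (arc D) x p, uniq (x :: p), last x p = v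
                         & size p = k])
          (has_path_to D v k).
Proof.
apply: (iffP existsP) => [[x /existsP[p /and3P[pP pU /eqP pv]]]|].
  by exists x, p; rewrite size_tuple.
move=> [x [p [pP pU pv /eqP sp]]]; exists x; apply/existsP; exists (Tuple sp).
by rewrite pP pU; apply/eqP.
Qed.

Lemma has_path_to_card D v k : has_path_to D v k -> k < #|V|.
Proof.
case/has_path_toP => x [p [_ pU _ <-]].
by have := max_card (mem (x :: p)); rewrite (card_uniqP pU).
Qed.

Lemma longest_path_to_ge D v k : has_path_to D v k -> k <= longest_path_to D v.
Proof.
move=> kP; rewrite /longest_path_to.
by rewrite (bigD1 (Ordinal (has_path_to_card kP))) //= leq_maxl.
Qed.

Lemma longest_path_to_attained D v : has_path_to D v (longest_path_to D v).
Proof.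
(* The default value 0 of the maximum is realised by the one-vertex path at [v]. *)
rewrite /longest_path_to; elim/big_ind: _ => [|a b aP bP|//].
  by apply/has_path_toP; exists v, [::].
by case: (leqP a b).
Qed.

(** Labels strictly increase along the path, so no vertex recurs. This discharges the distinctness
    demanded by [has_path_to]. *)
Lemma increasing_path_uniq D l x p :
  {homo l : u w / arc D u w >-> u < w} -> path (arc D) x p -> uniq (x :: p).
Proof.
move=> lP xp; apply: (@map_uniq _ _ l); apply: (sorted_uniq ltn_trans ltnn).
by apply: (homo_path lP).
Qed.

Lemma acyclic_increasing D :
  acyclic D -> exists l, {homo l : u w / arc D u w >-> u < w}.
Proof.
move=> [s [sU sP]].
have sT v : v \in s.
  have card_s : #|s| = #|V| by rewrite (card_uniqP sU) size_tuple.
  by rewrite (subset_cardP card_s (subset_predT _)).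
(* The label of a vertex is its position in the topological order. *)
exists (fun v => index v s) => u w; move: (sT u) (sT w).
case/tnthP => i ->; case/tnthP => j -> /sP.
have tK (m : 'I_#|V|) : index (tnth s m) s = m.
  by rewrite (tnth_nth u) index_uniq ?size_tuple.
by rewrite !tK.
Qed.

(** Appending an arc to a longest path gives strict growth. Deleting the last vertex of a longest
    path to [w] leaves a path to an in-neighbor of [w], whose level is then exactly one less. *)
Lemma longest_path_to_graded D : acyclic D -> graded D (longest_path_to D).
Proof.
case/acyclic_increasing => r rP.
have mono : {homo longest_path_to D : u w / arc D u w >-> u < w}.
  move=> u w uw; have /has_path_toP[x [p [pP _ pu sp]]] :=
    longest_path_to_attained D u.
  apply/longest_path_to_ge/has_path_toP; exists x, (rcons p w).
  have pwP : path (arc D) x (rcons p w) by rewrite rcons_path pP pu.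
  by rewrite (increasing_path_uniq rP pwP) last_rcons size_rcons sp.
split=> // w l0; have /has_path_toP[x [p [pP pU pw sp]]] :=
  longest_path_to_attained D w.
move: pP pU pw sp l0; case/lastP: p => [|p y]; first by move=> _ _ _ /= <-.
rewrite rcons_path last_rcons size_rcons => /andP[pP yP] _ defy sp _; subst y.
exists (last x p) => //; apply/eqP; rewrite eqn_leq mono // -sp ltnS.
apply/longest_path_to_ge/has_path_toP; exists x, p.
by rewrite (increasing_path_uniq rP pP).
Qed.

(** Each arc raises [l] by at least one, so no path to [v] has more than [l v] edges. Descending one
    grade at a time from [v] builds a path with exactly [l v] edges. *)
Lemma graded_longest_path D l v : graded D l -> longest_path_to D v = l v.
Proof.
move=> [mono down].
have path_le x p : path (arc D) x p -> l x + size p <= l (last x p).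
  elim: p x => [|y p IHp] x /=; first by rewrite addn0.
  case/andP => /mono xy /IHp; apply: leq_trans.
  by rewrite addnS -addSn leq_add2r.
have [x [p [pP pv sp]]] :
    exists x p, [/\ path (arc D) x p, last x p = v & size p = l v].
  move: {2}(l v) (erefl (l v)) => k; elim: k v => [|k IHk] v lv.
    by exists v, [::].
  have [|u uv luv] := down v; first by rewrite lv.
  have /IHk[x [p [pP pu sp]]] : l u = k by move: luv; rewrite lv => -[].
  exists x, (rcons p v).
  by rewrite rcons_path pP pu uv last_rcons size_rcons sp.
apply/eqP; rewrite eqn_leq; apply/andP; split.
  have /has_path_toP[y [q [/path_le qP _ <- <-]]] := longest_path_to_attained D v.
  exact: leq_trans (leq_addl _ _) qP.
apply/longest_path_to_ge/has_path_toP; exists x, p.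
by rewrite (increasing_path_uniq mono pP).
Qed.

Lemma graded_level D l k : graded D l -> level D k = [set v | l v == k].
Proof. by move=> lP; apply/setP => v; rewrite !inE (graded_longest_path v lP). Qed.

Lemma bigcup_graded_level D l n (I : {set 'I_n}) :
    graded D l ->
  \bigcup_(i in I) level D i = [set v | [exists i in I, l v == i]].
Proof.
move=> lP; apply/setP => v; rewrite inE.
apply/bigcupP/exists_inP => -[i iI].
  by rewrite (graded_level _ lP) inE; exists i.
by exists i; rewrite // (graded_level _ lP) inE.
Qed.

End Levels.

Lemma graded_iso (V W : finType) (D : digraph V) (H : digraph W) (f : V -> W)
    (g : W -> V) l :
    cancel f g -> cancel g f ->
    (forall u v, arc H (f u) (f v) = arc D u v) ->
  graded D l -> graded H (l \o g).
Proof.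
move=> fK gK arcf [mono down]; split=> [u w | w /down[u uw lu]] /=.
  by rewrite -{1}(gK u) -{1}(gK w) arcf; apply: mono.
by exists (f u); rewrite ?fK // -(gK w) arcf.
Qed.

(** * Invariance under local complementation and slides *)

Section BottMoves.
Variable V : finType.
Implicit Types (D : digraph V) (u v w x : V) (X Y : {set V}) (l : V -> nat).

Lemma local_compl_arcE D v u w :
  arc (local_compl D v) u w = arc D u w (+) [&& arc D u v, arc D v w & u != w].
Proof. by rewrite /arc !inE. Qed.

Lemma slide_arcE D v w (eqN : in_nbrs D v = in_nbrs D w) u x :
  arc (slide eqN) u x = arc D u x (+) ((u == w) && arc D v x).
Proof.
rewrite /arc !inE /= -!/(arc D _ _); case: eqP => [->|_]; last by rewrite addbF.
by case: (arc D w x); case: (arc D v x).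
Qed.

Lemma local_compl_cut_rank D l v X :
  graded D l -> cut_rank (local_compl D v) X = cut_rank D X.
Proof.
move=> [mono _].
have arcE u w : arc (local_compl D v) u w = arc D u w (+) (arc D u v && arc D v w).
  rewrite local_compl_arcE; case: eqP => [->|_]; last by rewrite andbT.
  rewrite !andbF; case: andP => // -[/mono lt1 /mono lt2].
  by have := ltn_trans lt1 lt2; rewrite ltnn.
case vX: (v \in X).
  by apply: (@cut_rank2_add_row _ _ _ _ _ (fun u => arc D u v) v) => //;
    rewrite arc_irrefl.
by apply: (@cut_rank2_add_col _ _ _ _ _ (fun w => arc D v w) v);
  rewrite ?inE ?vX ?arc_irrefl.
Qed.

Lemma local_compl_arc_short D l v u w :
  graded D l -> l w <= (l u).+1 -> arc (local_compl D v) u w = arc D u w.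
Proof.
move=> [mono _] lwu; rewrite local_compl_arcE.
case: and3P => [[/mono lt1 /mono lt2 _]|]; last by rewrite addbF.
by have := leq_trans (leq_ltn_trans lt1 lt2) lwu; rewrite ltnn.
Qed.

Lemma local_compl_graded D l v : graded D l -> graded (local_compl D v) l.
Proof.
move=> lP; have [mono down] := lP; split=> [u w | w /down[u uw lu]].
  rewrite local_compl_arcE; case uw: (arc D u w) => /=; first by move: uw => /mono.
  by case/and3P => /mono lt1 /mono lt2 _; apply: ltn_trans lt2.
by exists u; rewrite // (local_compl_arc_short _ lP) // lu.
Qed.

(** An in-neighbor of [x] one grade below it is also an in-neighbor of [y], so [y] lies at least as
    high; then exchange the two. *)
Lemma graded_in_nbrs D l v w :
  graded D l -> in_nbrs D v = in_nbrs D w -> l v = l w.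
Proof.
move=> [mono down].
suff le_in x y : in_nbrs D x = in_nbrs D y -> l x <= l y.
  by move=> eqN; apply/eqP; rewrite eqn_leq !le_in.
case: (posnP (l x)) => [->//|/down[u ux <-]] eqN; apply: mono.
by have := ux; rewrite -[arc D u x](in_set (arc D ^~ x)) -/(in_nbrs D x) eqN inE.
Qed.

Lemma slide_graded D l v w (eqN : in_nbrs D v = in_nbrs D w) :
  v != w -> graded D l -> graded (slide eqN) l.
Proof.
move=> neq lP; have [mono down] := lP; have lvw := graded_in_nbrs lP eqN.
split=> [u x | x /down[u ux lu]].
  rewrite slide_arcE; case ux: (arc D u x) => /=; first by move: ux => /mono.
  by case/andP => /eqP-> /mono; rewrite lvw.
(* If the slide removes the arc from [w] that witnessed the grade of [x], then [v], of the same
   grade and with its own arcs unchanged, replaces [w]. *)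
case wvx: ((u == w) && arc D v x); last by exists u; rewrite // slide_arcE ux wvx.
case/andP: wvx => /eqP defu vx; subst u.
by exists v; rewrite ?lvw // slide_arcE vx (negbTE neq).
Qed.

(** Only row [w] changes, by the addition of row [v], so [v] must be among the rows whenever [w] is.
    For unions of levels this holds because [v] and [w] share a grade. *)
Lemma slide_cut_rank2 D v w (eqN : in_nbrs D v = in_nbrs D w) X Y :
  v != w -> (w \in X -> v \in X) -> cut_rank2 (slide eqN) X Y = cut_rank2 D X Y.
Proof.
move=> neq wvX; case wX: (w \in X).
  apply: (@cut_rank2_add_row _ _ _ _ _ (pred1 w) v) => //; first exact: wvX.
  by move=> u x _ _; apply: slide_arcE.
apply: eq_cut_rank2 => u x uX _; rewrite slide_arcE.
by case: eqP uX => [->|_ _]; rewrite ?wX ?addbF.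
Qed.

(** One fixed [l] grades every digraph along the sequence of moves, so the vertex sets being
    compared never change. *)
Lemma bott_reachable_graded D D' l :
    bott_reachable D D' -> graded D l ->
  [/\ graded D' l,
      forall P : pred nat,
        cut_rank D' [set v | P (l v)] = cut_rank D [set v | P (l v)]
    & forall i, cut_rank2 D' [set v | l v == i] [set v | l v == i.+1] =
                cut_rank2 D [set v | l v == i] [set v | l v == i.+1]].
Proof.
move=> DD' lP.
elim: {D'} DD' => [//|D' v _ [l'P IH1 IH2]|D' v w eqN neq _ [l'P IH1 IH2]].
  split=> [|P|i]; first exact: local_compl_graded.
    by rewrite (local_compl_cut_rank _ _ l'P).
  rewrite -IH2; apply: eq_cut_rank2 => u w; rewrite !inE => /eqP lu /eqP lw.
  by rewrite (local_compl_arc_short _ l'P) // lu lw.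
have lvw := graded_in_nbrs l'P eqN.
split=> [|P|i]; first exact: slide_graded.
  by rewrite -IH1; apply: slide_cut_rank2; rewrite // !inE lvw.
by rewrite -IH2; apply: slide_cut_rank2; rewrite // !inE lvw.
Qed.

End BottMoves.

Theorem proposition5p3 (n : nat) (V W : finType) (D : digraph V) (H : digraph W)
    (cardV : #|V| = n) (cardW : #|W| = n)
    (acyclicD : acyclic D) (acyclicH : acyclic H)
    (bottDH : bott_equivalent H D) :
  (forall I : {set 'I_n},
     cut_rank D (\bigcup_(i in I) level D i) =
     cut_rank H (\bigcup_(i in I) level H i)) /\
  (forall i : nat, i.+1 < n ->
     cut_rank2 D (level D i) (level D i.+1) =
     cut_rank2 H (level H i) (level H i.+1)).
Proof.
(* The longest-path function of [D] is generalised to an arbitrary grading [l]. Transported along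
   the isomorphism, it becomes the grading [l \o g] of [H]. *)
have lP := longest_path_to_graded acyclicD; move: (longest_path_to D) lP => l lP.
case: bottDH => D' DD' [f fB arcf]; have [g fK gK] := fB.
have [l'P rank1 rank2] := bott_reachable_graded DD' lP.
have hP := graded_iso fK gK arcf l'P.
split=> [I|i _].
  rewrite !(bigcup_graded_level _ lP) !(bigcup_graded_level _ hP).
  rewrite -(rank1 (fun k => [exists i in I, k == i])); symmetry.
  by apply: (cut_rank2_iso fB arcf) => u; rewrite !inE /= fK.
rewrite !(graded_level _ lP) !(graded_level _ hP) -rank2; symmetry.
by apply: (cut_rank2_iso fB arcf) => u; rewrite !inE /= fK.
Qed.
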